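(* Let $s\ge 1$ be an integer, let $d_1,\dots,d_s$ be positive integers, and let $W(n,d^s)$ be the restricted partition function defined by the formal power series identity $\prod_{i=1}^{s}\frac{1}{1-x^{d_i}}=\sum_{n\ge0}W(n,d^s)x^n$. Then for every integer $n\ge1$, $$W(n,d^s)=\sum_{(k_1,\dots,k_n)\in\pi(n)}\prod_{j=1}^{n}\left[\frac{1}{k_j!}\left(\frac{d_S(j)}{j}\right)^{k_j}\right].$$
   Context: The set $\mathbb{N}$ contains $0$. For $n\ge1$, $\pi(n)=\{(k_1,\dots,k_n)\in\mathbb{N}^n : k_1+2k_2+\cdots+nk_n=n\}$. $W(n,d^s)=W(n,\{d_1,\dots,d_s\})$ is the number of partitions of $n$ into parts taken from $d_1,\dots,d_s$. The restricted divisor function $d_S$, with $S=\{d_1,\dots,d_s\}$, is $d_S(j)=\sum_{1\le i\le s,\ d_i\mid j} d_i$ for $j\ge 1$. *)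

(* Defs.v *)
From HB Require Import structures.
From mathcomp Require Import all_boot all_order all_algebra.
From mathcomp Require Import boolp.
Set Implicit Arguments.
Unset Strict Implicit.
Unset Printing Implicit Defensive.
Import GRing.Theory.
Local Open Scope ring_scope.

(* The ring R[[x]] of formal power series. Equality of coefficient functions
   is extensional, hence the classical eqType and choiceType structures. *)
Record fps (R : Type) := FPS { fps_coef : nat -> R }.

Notation "f .[coef n ]" := (fps_coef f n)
  (at level 2, left associativity, format "f .[coef  n ]") : ring_scope.

HB.instance Definition _ (R : Type) := gen_eqMixin (fps R).
HB.instance Definition _ (R : Type) := gen_choiceMixin (fps R).

Lemma fpsP (R : Type) (f g : fps R) :
  (forall n, f.[coef n] = g.[coef n]) <-> f = g.
Proof.
split=> [|-> //]; case: f g => [u] [v] /= uv.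
by congr FPS; apply/funext.
Qed.

Section FpsZmodule.
Variable R : zmodType.
Implicit Types f g h : fps R.

Definition fps_zero : fps R := FPS (fun=> 0).
Definition fps_opp f : fps R := FPS (fun n => - f.[coef n]).
Definition fps_add f g : fps R := FPS (fun n => f.[coef n] + g.[coef n]).

Fact fps_addA : associative fps_add.
Proof. by move=> f g h; apply/fpsP => n /=; rewrite addrA. Qed.
Fact fps_addC : commutative fps_add.
Proof. by move=> f g; apply/fpsP => n /=; rewrite addrC. Qed.
Fact fps_add0 : left_id fps_zero fps_add.
Proof. by move=> f; apply/fpsP => n /=; rewrite add0r. Qed.
Fact fps_addN : left_inverse fps_zero fps_opp fps_add.
Proof. by move=> f; apply/fpsP => n /=; rewrite addNr. Qed.

HB.instance Definition _ :=
  GRing.isZmodule.Build (fps R) fps_addA fps_addC fps_add0 fps_addN.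

End FpsZmodule.

Section FpsRing.
Variable R : comNzRingType.
Implicit Types f g h : fps R.

Definition fps_one : fps R := FPS (fun n => (n == 0%N)%:R).
Definition fps_mul f g : fps R :=
  FPS (fun n => \sum_(i < n.+1) f.[coef i] * g.[coef (n - i)]).

Definition fps_trunc n f : {poly R} := \poly_(i < n.+1) f.[coef i].

Lemma coef_fps_mul n f g (p q : {poly R}) :
    (forall i, (i <= n)%N -> p`_i = f.[coef i]) ->
    (forall i, (i <= n)%N -> q`_i = g.[coef i]) ->
  forall i, (i <= n)%N -> (p * q)`_i = (fps_mul f g).[coef i].
Proof.
move=> pf qg i le_in; rewrite coefM /=; apply: eq_bigr => j _.
rewrite pf ?qg //; first by rewrite (leq_trans (leq_subr _ _)).
by rewrite (leq_trans _ le_in) // -ltnS.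
Qed.

Lemma coef_fps_trunc n f i : (i <= n)%N -> (fps_trunc n f)`_i = f.[coef i].
Proof. by move=> le_in; rewrite coef_poly ltnS le_in. Qed.

Fact fps_mulA : associative fps_mul.
Proof.
move=> f g h; apply/fpsP => n; have T := @coef_fps_trunc n.
rewrite -(coef_fps_mul (T f) (coef_fps_mul (T g) (T h)) (leqnn n)).
by rewrite -(coef_fps_mul (coef_fps_mul (T f) (T g)) (T h) (leqnn n)) mulrA.
Qed.
Fact fps_mulC : commutative fps_mul.
Proof.
move=> f g; apply/fpsP => n; have T := @coef_fps_trunc n.
by rewrite -!(coef_fps_mul (T _) (T _) (leqnn n)) mulrC.
Qed.
Fact fps_mul1 : left_id fps_one fps_mul.
Proof.
move=> f; apply/fpsP => n /=.
rewrite big_ord_recl mul1r subn0 big1 ?addr0 // => i _.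
by rewrite mul0r.
Qed.
Fact fps_mulDl : left_distributive fps_mul +%R.
Proof.
move=> f g h; apply/fpsP => n /=; rewrite -big_split /=.
by apply: eq_bigr => i _; rewrite mulrDl.
Qed.
Fact fps_one_neq0 : fps_one != 0.
Proof.
apply/eqP => /fpsP/(_ 0)/= /eqP.
by rewrite oner_eq0.
Qed.

HB.instance Definition _ := GRing.Zmodule_isComNzRing.Build (fps R)
  fps_mulA fps_mulC fps_mul1 fps_mulDl fps_one_neq0.

Definition fpsX : fps R := FPS (fun n => (n == 1%N)%:R).

Lemma coef_fpsM f g n :
  (f * g).[coef n] = \sum_(i < n.+1) f.[coef i] * g.[coef (n - i)].
Proof. by []. Qed.

Lemma coef_fps1 n : (1 : fps R).[coef n] = (n == 0%N)%:R.
Proof. by []. Qed.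

End FpsRing.

Arguments fpsX {R}.

Section FpsUnit.
Variable R : comUnitRingType.
Implicit Types f g : fps R.

Definition fps_unit : {pred fps R} := [pred f | f.[coef 0] \is a GRing.unit].

(* The coefficients g_0, ..., g_n of g = f^-1, from g_0 = f_0^-1 and
   f_0 g_(m+1) = - (f_1 g_m + ... + f_(m+1) g_0). *)
Fixpoint fps_inv_seq f n : seq R :=
  if n is m.+1 then
    let t := fps_inv_seq f m in
    rcons t (- (f.[coef 0]^-1 * \sum_(i < m.+1) f.[coef i.+1] * t`_(m - i)))
  else [:: f.[coef 0]^-1].

Definition fps_inv f : fps R :=
  if f \in fps_unit then FPS (fun n => (fps_inv_seq f n)`_n) else f.

Lemma size_fps_inv_seq f n : size (fps_inv_seq f n) = n.+1.
Proof. by elim: n => //= n IHn; rewrite size_rcons IHn. Qed.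

Lemma nth_fps_inv_seq f n i : (i <= n)%N ->
  (fps_inv_seq f n)`_i = (fps_inv_seq f i)`_i.
Proof.
elim: n => [|n IHn]; first by case: i.
rewrite leq_eqVlt => /predU1P[-> //|lt_in].
by rewrite [fps_inv_seq f n.+1]/= nth_rcons size_fps_inv_seq lt_in IHn.
Qed.

Fact fps_mulVf : {in fps_unit, left_inverse 1 fps_inv *%R}.
Proof.
move=> f Uf; rewrite mulrC; apply/fpsP => n.
rewrite coef_fpsM coef_fps1 /fps_inv Uf /=; case: n => [|n].
  by rewrite big_ord1 /= divrr.
rewrite big_ord_recl subn0 [fps_inv_seq f n.+1]/= nth_rcons.
rewrite size_fps_inv_seq ltnn eqxx mulrN mulVKr // addrC; apply/eqP.
rewrite subr_eq0; apply/eqP/eq_bigr => i _.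
by rewrite lift0 subSS [in RHS]nth_fps_inv_seq ?leq_subr.
Qed.

Fact fps_unitPl f g : g * f = 1 -> fps_unit f.
Proof.
move=> /fpsP/(_ 0); rewrite coef_fpsM big_ord1 coef_fps1 /= => gf1.
by apply/unitrPr; exists g.[coef 0]; rewrite mulrC.
Qed.

Fact fps_inv_out : {in [predC fps_unit], fps_inv =1 id}.
Proof. by move=> f /negbTE nUf; rewrite /fps_inv nUf. Qed.

HB.instance Definition _ := GRing.ComNzRing_hasMulInverse.Build (fps R)
  fps_mulVf fps_unitPl fps_inv_out.

Lemma fps_unitE f : (f \is a GRing.unit) = (f.[coef 0] \is a GRing.unit).
Proof. by []. Qed.

End FpsUnit.

Lemma coef_fpsXn (R : comNzRingType) m n :
  (fpsX ^+ m : fps R).[coef n] = (n == m)%:R.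
Proof.
elim: m n => [//|m IHm] n; rewrite exprS coef_fpsM.
case: n => [|n]; first by rewrite big_ord1 mul0r.
rewrite big_ord_recl mul0r add0r big_ord_recl mul1r IHm subSS subn0 eqSS.
by rewrite big1 ?addr0 // => i _; rewrite mul0r.
Qed.

(* Together with mulVr, this shows that the inverses in restricted_partition
   are genuine ones. *)
Lemma fps_unit_1subXn (R : comUnitRingType) m : (0 < m)%N ->
  (1 - fpsX ^+ m : fps R) \is a GRing.unit.
Proof.
by case: m => // m _; rewrite fps_unitE /= coef_fpsXn subr0 unitr1.
Qed.

(* The d_i need not be distinct: a value occurring several times counts as
   that many different kinds of parts. *)
Definition restricted_partition s (d : 'I_s -> nat) (n : nat) : rat :=
  (\prod_(i < s) (1 - fpsX ^+ d i)^-1).[coef n].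

Definition restricted_divisor s (d : 'I_s -> nat) (j : nat) : nat :=
  (\sum_(i < s | d i %| j) d i)%N.

(* k_1, ..., k_n is indexed from 0, so that the entry k j stands for k_(j+1).
   Taking the entries in {0, ..., n} loses nothing, by pi_set_bound. *)
Definition pi_set n : {set {ffun 'I_n -> 'I_n.+1}} :=
  [set k : {ffun 'I_n -> 'I_n.+1} | (\sum_(j < n) j.+1 * k j == n)%N].

Lemma pi_set_bound n (k : 'I_n -> nat) :
  (\sum_(j < n) j.+1 * k j = n)%N -> forall j, (k j < n.+1)%N.
Proof.
move=> kn j; rewrite ltnS -[leqRHS]kn (bigD1 j) //=.
by rewrite (leq_trans _ (leq_addr _ _)) // leq_pmull.
Qed.

(* Main.v *)
Require Import Defs.
From mathcomp Require Import all_boot all_order all_algebra.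
Import GRing.Theory.
Local Open Scope ring_scope.

Set Implicit Arguments.
Unset Strict Implicit.
Unset Printing Implicit Defensive.

(** Both sides of the identity are coefficients of x^n in products of power
    series, and the two products have the same logarithmic derivative up to
    degree n.  Write theta = x d/dx for the Euler derivation, so that
    theta multiplies the coefficient of x^m by m, and f_d for 1 / (1 - x^d).

    On the left, theta f_d = f_d * d (f_d - 1), and the coefficient of x^j in
    d (f_d - 1) is d if d divides j > 0, and 0 otherwise.  Logarithmic
    derivatives add up over products, so the product P of the f_(d_i) satisfies
    theta P = P * A, where A = sum_(j > 0) d_S(j) x^j.

    On the right, the sum over pi(n) is what one obtains by expanding
    the product of the exponentials exp (d_S(j) / j * x^j) for 1 <= j <= n and
    reading off the coefficient of x^n [coef_prod_fps_dilate].  The logarithmic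
    derivative of the j-th factor is d_S(j) x^j, so that of the product is A
    truncated at degree n.

    An equation theta f = f * A with A_0 = 0 is the recurrence
    m f_m = sum_(i < m) f_i A_(m-i), which determines f_0, ..., f_n from f_0 and
    A_1, ..., A_n [fps_theta_uniq].  Both products have constant term 1, hence
    they agree up to degree n. *)

(** * Coefficients of power series *)

Section Coefficients.
Variable R : comNzRingType.
Implicit Types f g : fps R.

Lemma coef_fps_sum I (r : seq I) (F : I -> fps R) n :
  (\sum_(i <- r) F i).[coef n] = \sum_(i <- r) (F i).[coef n].
Proof. by elim/big_rec2: _ => // i _ y _ <-. Qed.

Lemma coef_fpsMn f m n : (f *+ m).[coef n] = f.[coef n] *+ m.
Proof. by elim: m => // m IHm; rewrite !mulrS -IHm. Qed.

Definition fps_monom (a : R) m : fps R := FPS (fun n => a *+ (n == m)).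

Lemma coef_fps_monomM a m f n :
  (fps_monom a m * f).[coef n]
  = if (m <= n)%N then a * f.[coef (n - m)] else 0.
Proof.
rewrite coef_fpsM; case: leqP => [le_mn | lt_nm].
  rewrite (bigD1 (inord m)) //= inordK ?ltnS // eqxx big1 ?addr0 // => i ne_im.
  rewrite (_ : (i == m :> nat) = false) ?mul0r //.
  by apply: contra_neqF ne_im => /eqP <-; rewrite inord_val.
rewrite big1 // => i _ /=.
by rewrite ltn_eqF ?mul0r // (leq_ltn_trans _ lt_nm) // -ltnS.
Qed.

Lemma fpsXnE m : fpsX ^+ m = fps_monom 1 m.
Proof. by apply/fpsP => n; rewrite coef_fpsXn. Qed.

(** The series sum_q u_q x^(m q), that is, u(x^m). *)
Definition fps_dilate m (u : nat -> R) : fps R :=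
  FPS (fun n => if (m %| n)%N then u (n %/ m)%N else 0).

Lemma coef_prod_fps n I (r : seq I) (p : I -> {poly R}) (f : I -> fps R) :
    (forall i j, (j <= n)%N -> (p i)`_j = (f i).[coef j]) ->
  forall j, (j <= n)%N ->
    (\prod_(i <- r) p i)`_j = (\prod_(i <- r) f i).[coef j].
Proof.
move=> pf; elim/big_rec2: _ => [|i g q _ IHq]; first by move=> j _; rewrite coef1.
move=> j le_jn; exact: (coef_fps_mul (pf i) IHq le_jn).
Qed.

(** Replacing each factor by a polynomial with the same terms up to degree [n]
    makes the product one of finite sums, and distributivity turns it into a
    sum over all choices [k] of one term from each factor. *)
Lemma coef_prod_fps_dilate n (u : 'I_n -> nat -> R) :
  (\prod_(j < n) fps_dilate j.+1 (u j)).[coef n]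
  = \sum_(k in pi_set n) \prod_(j < n) u j (k j).
Proof.
(* As j + 1 >= 1, exponents k > n only contribute to degrees above n. *)
pose p (j : 'I_n) : {poly R} := \sum_(k < n.+1) u j k *: 'X^(j.+1 * k).
have pE j i : (i <= n)%N -> (p j)`_i = (fps_dilate j.+1 (u j)).[coef i].
  move=> le_in; rewrite coef_sum /=; case: ifP => [dvd_ji | ndvd_ji].
    have qP : (i %/ j.+1 < n.+1)%N by rewrite ltnS (leq_trans (leq_div _ _)).
    rewrite (bigD1 (Ordinal qP)) //= big1 ?addr0 => [|k ne_k].
      by rewrite coefZ coefXn mulnC divnK // eqxx mulr1.
    rewrite coefZ coefXn (_ : (_ == _) = false) ?mulr0 //.
    by apply: contra_neqF ne_k => /eqP i_jk; apply: val_inj; rewrite /= i_jk mulKn.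
  rewrite big1 // => k _; rewrite coefZ coefXn (_ : (_ == _) = false) ?mulr0 //.
  by apply: contraFF ndvd_ji => /eqP ->; apply: dvdn_mulr.
rewrite -(coef_prod_fps (index_enum _) pE) // bigA_distr_bigA coef_sum /=.
rewrite [RHS]big_mkcond; apply: eq_bigr => k _.
rewrite GRing.scaler_prod prodrXr coefZ coefXn inE eq_sym.
by case: (_ == _); rewrite ?mulr1 ?mulr0.
Qed.

End Coefficients.

(** * The Euler derivation and logarithmic derivatives *)

Section EulerDerivation.
Variable R : comNzRingType.
Implicit Types f g A : fps R.

(** The operator x d/dx, preferred to d/dx because it preserves degrees. *)
Definition fps_theta f : fps R := FPS (fun n => f.[coef n] *+ n).

Lemma fps_thetaM f g : fps_theta (f * g) = fps_theta f * g + f * fps_theta g.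
Proof.
apply/fpsP => n; rewrite /= -sumrMnl -big_split /=; apply: eq_bigr => i _.
by rewrite mulrnAl mulrnAr -mulrnDr subnKC // -ltnS.
Qed.

Lemma fps_theta1 : fps_theta 1 = 0.
Proof. by apply/fpsP => -[|n] //=; rewrite mul0rn. Qed.

(** By the Leibniz rule, logarithmic derivatives [A i] = theta [f i] / [f i]
    add up over products. *)
Lemma fps_theta_prod I (r : seq I) (f A : I -> fps R) :
    (forall i, fps_theta (f i) = f i * A i) ->
  fps_theta (\prod_(i <- r) f i)
  = (\prod_(i <- r) f i) * \sum_(i <- r) A i.
Proof.
move=> fA; elim/big_rec2: _ => [|i B g _ IHg]; first by rewrite mulr0 fps_theta1.
by rewrite fps_thetaM IHg fA mulrDr mulrAC mulrA.
Qed.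

Lemma coef0_prod_fps I (r : seq I) (f : I -> fps R) :
  (forall i, (f i).[coef 0] = 1) -> (\prod_(i <- r) f i).[coef 0] = 1.
Proof.
move=> f1; elim/big_rec: _ => // i g _ g1.
by rewrite coef_fpsM big_ord1 f1 g1 mulr1.
Qed.

End EulerDerivation.

(** Reading off coefficients of theta f = f * A gives the recurrence
    m f_m = sum_(i < m) f_i A_(m-i): the summand f_m A_0 vanishes, and m can be
    cancelled when it is positive. *)
Lemma fps_theta_uniq (R : numDomainType) n (f g A B : fps R) :
    fps_theta f = f * A -> fps_theta g = g * B -> f.[coef 0] = g.[coef 0] ->
    A.[coef 0] = 0 -> (forall i, (i <= n)%N -> A.[coef i] = B.[coef i]) ->
  forall i, (i <= n)%N -> f.[coef i] = g.[coef i].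
Proof.
move=> fA gB fg0 A0 AB i; elim/ltn_ind: i => -[//|i] IHi le_in.
apply: (Num.Theory.pmulrnI (ltn0Sn i)).
have /fpsP/(_ i.+1)/= -> := fA; have /fpsP/(_ i.+1)/= -> := gB.
rewrite big_ord_recr [in RHS]big_ord_recr /= subnn -(AB 0) //.
rewrite A0 !mulr0 !addr0; apply: eq_bigr => j _.
rewrite IHi ?AB //; first by rewrite (leq_trans (leq_subr _ _)).
by rewrite (leq_trans _ le_in) // ltnW.
Qed.

(** * Geometric series *)

Section Geometric.
Variable R : comUnitRingType.

Definition fps_geom d : fps R := fps_dilate d (fun=> 1).

Lemma fps_geomE d : (0 < d)%N -> fpsX ^+ d * fps_geom d = fps_geom d - 1.
Proof.
move=> d_gt0; apply/fpsP => n; rewrite fpsXnE coef_fps_monomM mul1r /=.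
case: leqP => [le_dn | lt_nd].
  by rewrite dvdn_subl // gtn_eqF ?subr0 // (leq_trans d_gt0).
case: n lt_nd => [|n] lt_nd; first by rewrite dvdn0 subrr.
by rewrite gtnNdvd // subr0.
Qed.

Lemma inv_1subXn d : (0 < d)%N -> (1 - fpsX ^+ d)^-1 = fps_geom d.
Proof.
move=> d_gt0; apply: (mulrI (fps_unit_1subXn R d_gt0)).
rewrite divrr ?fps_unit_1subXn // mulrBl mul1r fps_geomE //.
by rewrite opprB addrCA subrr addr0.
Qed.

(** With f = 1 / (1 - x^d), applying theta to (1 - x^d) f = 1 gives
    (1 - x^d) theta f = d x^d f = d (f - 1). *)
Lemma fps_theta_geom d : (0 < d)%N ->
  fps_theta (fps_geom d) = fps_geom d * ((fps_geom d - 1) *+ d).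
Proof.
move=> d_gt0; have Ud := fps_unit_1subXn R d_gt0.
have fE: (1 - fpsX ^+ d) * fps_geom d = 1 by rewrite -inv_1subXn // divrr.
have thetaX: fps_theta (1 - fpsX ^+ d) = - (fpsX ^+ d *+ d) :> fps R.
  apply/fpsP => n; rewrite /= coef_fpsMn !coef_fpsXn mulrnBl.
  rewrite [X in X - _](_ : _ = 0) ?sub0r; last by case: n => [|n]; rewrite ?mul0rn.
  by case: eqVneq => [-> | _]; rewrite ?mul0rn.
have: fps_theta ((1 - fpsX ^+ d) * fps_geom d) = 0 by rewrite fE fps_theta1.
rewrite fps_thetaM thetaX mulNr mulrnAl fps_geomE // => /eqP.
rewrite addrC subr_eq0 => /eqP thetaf; apply: (mulrI Ud).
by rewrite thetaf mulrA fE mul1r.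
Qed.

End Geometric.

(** * Exponentials *)

Section Exponential.
Variable R : numFieldType.

(** The coefficients of exp (a * x). *)
Definition exp_coef (a : R) k := (k`!)%:R^-1 * a ^+ k.

Lemma exp_coefS a k : exp_coef a k.+1 *+ k.+1 = a * exp_coef a k.
Proof.
rewrite /exp_coef factS natrM invfM -mulr_natl exprS !mulrA.
by rewrite divff ?mul1r 1?[a * _]mulrC // Num.Theory.pnatr_eq0.
Qed.

(** The series is exp (c x^m') with m' = m + 1 and c = a / m'; the scaling by
    1 / m' is chosen to cancel the factor m' in theta (c x^m') = m' c x^m'. *)
Lemma fps_theta_exp a m :
  fps_theta (fps_dilate m.+1 (exp_coef (a / m.+1%:R)))
  = fps_dilate m.+1 (exp_coef (a / m.+1%:R)) * fps_monom a m.+1.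
Proof.
rewrite [RHS]mulrC; apply/fpsP => n; rewrite coef_fps_monomM /=.
case: ltnP => [lt_mn | le_nm]; last first.
  by case: n le_nm => [|n] lt_nm; rewrite ?mulr0n // gtnNdvd // mul0rn.
rewrite dvdn_subl //; case: ifP => [/dvdnP[q nE] | _]; last by rewrite mul0rn mulr0.
case: q nE lt_mn => [|q] -> // _; rewrite mulSn addKn -mulSn !mulnK //.
rewrite mulrnA exp_coefS -mulrnAl -[in LHS]mulr_natr divfK //.
by rewrite Num.Theory.pnatr_eq0.
Qed.

End Exponential.

Theorem theorem3p2 (s : nat) (hs : (1 <= s)%N)
    (d : 'I_s -> nat) (hd : forall i : 'I_s, (0 < d i)%N)
    (n : nat) (hn : (1 <= n)%N) :
  restricted_partition d n =
  \sum_(k in pi_set n) \prod_(j < n)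
     (((k j)`!)%:R^-1
      * ((restricted_divisor d j.+1)%:R / (j.+1)%:R) ^+ k j) :> rat.
Proof.
pose a j : rat := (restricted_divisor d j)%:R.
rewrite /restricted_partition.
rewrite -(coef_prod_fps_dilate (fun j : 'I_n => exp_coef (a j.+1 / j.+1%:R))).
under eq_bigr do rewrite inv_1subXn //.
have thetaL := fps_theta_prod (index_enum _) (fun i => fps_theta_geom rat (hd i)).
have thetaR := fps_theta_prod (index_enum _)
                 (fun j : 'I_n => fps_theta_exp (a j.+1) j).
have coefA i : (\sum_(j < s) (fps_geom rat (d j) - 1) *+ d j).[coef i]
             = if i is 0 then 0 else a i.
  rewrite coef_fps_sum; case: i => [|i].
    by rewrite big1 // => j _; rewrite coef_fpsMn /= dvdn0 subrr mul0rn.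
  rewrite /a /restricted_divisor natr_sum [RHS]big_mkcond; apply: eq_bigr => j _.
  by rewrite coef_fpsMn /= subr0; case: ifP; rewrite ?mul0rn.
apply: (fps_theta_uniq thetaL thetaR) (leqnn n) => [||i le_in].
- by rewrite !coef0_prod_fps // => j /=; rewrite dvdn0.
- by rewrite coefA.
rewrite coefA coef_fps_sum; case: i le_in => [|i] lt_in.
  by rewrite big1.
rewrite (bigD1 (Ordinal lt_in)) //= eqxx big1 ?addr0 // => j ne_ji.
by rewrite eqSS eq_sym (negPf (ne_ji : j != i :> nat)).
Qed.
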